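(* For every positive integer $k$ and every real $\delta>0$, there exists a multiset of deadlines $D$ with $\mathrm{Dens}(D)>\delta$ that admits a $k$-Visits schedule. Equivalently, $k$-Visits has no upper density threshold, for any $k$.
   Context: $k$-Visits: given a multiset of positive integers (deadlines) $D=\{d_1,\ldots,d_n\}$, a $k$-Visits schedule is a sequence of length $nk$ with entries in $[n]$, containing each $i$ exactly $k$ times, such that the first occurrence of $i$ is within the first $d_i$ positions and every later occurrence of $i$ is at most $d_i$ positions after the previous one. The density of $D$ is $\mathrm{Dens}(D)=\sum_i 1/d_i$. The upper density threshold of a problem is the smallest value above which no instance admits a schedule. *)

(* Defs.v *)
From mathcomp Require Import all_boot all_order all_algebra.
From mathcomp Require Import reals.

Set Implicit Arguments.
Unset Strict Implicit.
Unset Printing Implicit Defensive.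

Import Order.TTheory GRing.Theory Num.Theory.
Local Open Scope ring_scope.

(* A multiset {d_1, ..., d_n} of deadlines is represented by an enumeration
   d : 'I_n -> nat of its elements; repetitions are allowed and the order of
   the enumeration is irrelevant to all the notions below. *)
Definition positive_deadlines (n : nat) (d : 'I_n -> nat) : Prop :=
  forall i, (0 < d i)%N.

Definition dens (R : realType) (n : nat) (d : 'I_n -> nat) : R :=
  \sum_(i < n) (d i)%:R^-1.

(* Positions are numbered from 0, so "the first occurrence of i is within the
   first d_i positions" reads [index i s < d i].  In the last clause p and q
   are the positions of two consecutive occurrences of i. *)
Definition kvisits_schedule (k n : nat) (d : 'I_n -> nat)
    (s : (n * k).-tuple 'I_n) : Prop :=
  [/\ forall i, count_mem i s = k,
      forall i, (index i s < d i)%N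
    & forall (i : 'I_n) (p q : 'I_(n * k)),
        (p < q)%N -> tnth s p = i -> tnth s q = i ->
        (forall r : 'I_(n * k), (p < r < q)%N -> tnth s r <> i) ->
        (q - p <= d i)%N].

Definition kvisits_schedulable (k n : nat) (d : 'I_n -> nat) : Prop :=
  exists s : (n * k).-tuple 'I_n, kvisits_schedule d s.

Definition no_schedule_above (R : realType) (k : nat) (t : R) : Prop :=
  forall (n : nat) (d : 'I_n -> nat),
    positive_deadlines d -> t < dens R d -> ~ kvisits_schedulable k d.

Definition upper_density_threshold (R : realType) (k : nat) (t : R) : Prop :=
  no_schedule_above k t /\
  forall t' : R, no_schedule_above k t' -> t <= t'.

(* Main.v *)
(* Visiting 1, ..., n one after the other, k times in a row each, makes every
   gap equal to 1, so the only constraint on d_i is the position k(i-1)+1 of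
   the first visit. With equality there, the density dominates 1/k times the
   n-th harmonic number, which is unbounded. *)
Require Import Defs.
From mathcomp Require Import all_boot all_order all_algebra.
From mathcomp Require Import reals.

Set Implicit Arguments.
Unset Strict Implicit.
Unset Printing Implicit Defensive.

Import Order.TTheory GRing.Theory Num.Theory.
Local Open Scope ring_scope.

(** Dyadic grouping: passing from [2 ^ m] to [2 ^ m.+1] terms adds [2 ^ m] new terms, each at least
    the inverse of [2 ^ m.+1], so every doubling contributes at least [1/2]. *)
Lemma harmonic_sum_pow2 (R : realType) (m : nat) :
  m%:R / 2 <= \sum_(0 <= i < 2 ^ m) i.+1%:R^-1 :> R.
Proof.
elim: m => [|m IHm]; first by rewrite mul0r sumr_ge0 // => i _; rewrite invr_ge0.
rewrite expnS (@big_cat_nat _ _ _ (2 ^ m)) ?leq_pmull //= -natr1 mulrDl mul1r.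
rewrite lerD //.
have -> : 2^-1 = \sum_(2 ^ m <= i < 2 * 2 ^ m) (2 * 2 ^ m)%:R^-1 :> R.
  rewrite sumr_const_nat mul2n -addnn addnK addnn -mul2n.
  by rewrite -[RHS]mulr_natr natrM invfM -mulrA mulVf ?mulr1 // pnatr_eq0 expn_eq0.
apply: ler_sum_nat => i /andP[_ lti].
by rewrite lef_pV2 ?posrE ?ltr0n ?muln_gt0 ?expn_gt0 ?ler_nat.
Qed.

Lemma harmonic_sum_unbounded (R : realType) (x : R) :
  exists n : nat, x < \sum_(i < n) i.+1%:R^-1.
Proof.
have [m ltxm] : exists m : nat, x * 2 < m%:R.
  by exists (Num.truncn (x * 2)).+1; exact: truncnS_gt.
exists (2 ^ m)%N; rewrite -(big_mkord xpredT (fun i => i.+1%:R^-1)).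
by apply: lt_le_trans (harmonic_sum_pow2 R m); rewrite ltr_pdivlMr.
Qed.

Section BlockSchedule.

Variables (n k : nat) (k_gt0 : (0 < k)%N).

Lemma ltn_block (p : 'I_(n * k)) : (p %/ k < n)%N.
Proof. by rewrite ltn_divLR. Qed.

Definition block_schedule : (n * k).-tuple 'I_n :=
  mktuple (fun p => Ordinal (ltn_block p)).

(** Since [i] and the positions count from 0, block [i] starts at position [i * k]; the strict bound
    on [index] makes the successor the least admissible deadline. *)
Definition block_deadline (i : 'I_n) : nat := (i * k).+1.

(** Cut the positions into [n] blocks of length [k]: [p %/ k] is constantly [j] on block [j], so
    only block [i] contributes, once per position. *)
Lemma count_block_schedule (i : 'I_n) : count_mem i block_schedule = k.
Proof.
rewrite -sum1_count big_tuple big_mkcond /=.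
under eq_bigr do rewrite tnth_mktuple -val_eqE /=.
rewrite -(big_mkord xpredT (fun p => if p %/ k == i then 1 else 0)%N).
rewrite big_nat_mul /= big_mkord (bigD1 i) //=.
have blockE (j : nat) : (\sum_(j * k <= p < j.+1 * k)
    (if p %/ k == i then 1 else 0) = if j == i then k else 0)%N.
  rewrite (eq_big_nat _ _ (F2 := fun=> if j == i then 1 else 0)%N).
    by rewrite sum_nat_const_nat mulSn addnK; case: eqP; rewrite ?muln1 ?muln0.
  move=> p /andP[lejp ltpj]; congr (if _ == _ then _ else _); apply/eqP.
  by rewrite eqn_leq leq_divRL // lejp -ltnS ltn_divLR // ltpj.
rewrite blockE eqxx big1 ?addn0 // => j /negPf neji.
by rewrite blockE val_eqE neji.
Qed.

Lemma block_schedule_kvisits : kvisits_schedule block_deadline block_schedule.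
Proof.
split=> [|i|i p q ltpq <- /(congr1 val) + no_between].
- exact: count_block_schedule.
- have lt_ik : (i * k < n * k)%N by rewrite ltn_pmul2r.
  (* The first occurrence cannot come after position [i * k], whose entry is already [i]. *)
  rewrite ltnS leqNgt; apply/negP => /(before_find i) /negP; apply.
  rewrite -(tnth_nth i block_schedule (Ordinal lt_ik)) tnth_mktuple.
  by apply/eqP/val_inj; rewrite /= mulnK.
rewrite !tnth_mktuple /= => eq_qp.
(* If [q] were not [p.+1], position [p.+1] would lie strictly between them; by monotonicity of
   [%/ k] its entry is the same, contradicting consecutiveness. *)
have [/eqP <-|neq] := boolP (p.+1 == q :> nat); first by rewrite subSnn.
have lt1q : (p.+1 < q)%N by rewrite ltn_neqAle neq.
have [] := no_between (Ordinal (ltn_trans lt1q (ltn_ord q))).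
  by rewrite /= ltnSn.
rewrite !tnth_mktuple; apply/val_inj/eqP => /=.
by rewrite eqn_leq -{1}eq_qp !leq_div2r // ltnW.
Qed.

(** Termwise, [i * k + 1 <= k * (i + 1)] because [k] is at least 1. *)
Lemma dens_block_deadline (R : realType) :
  k%:R^-1 * \sum_(i < n) i.+1%:R^-1 <= dens R block_deadline.
Proof.
rewrite mulr_sumr ler_sum // => i _.
rewrite -invfM -natrM lef_pV2 ?posrE ?ltr0n ?muln_gt0 ?k_gt0 // ler_nat.
by rewrite mulnS [(k * i)%N]mulnC -[block_deadline i]add1n leq_add2r.
Qed.

End BlockSchedule.

Theorem theorem13 (R : realType) (k : nat) (hk : (0 < k)%N) :
  (forall delta : R, 0 < delta ->
     exists (n : nat) (d : 'I_n -> nat),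
       [/\ positive_deadlines d, delta < dens R d & kvisits_schedulable k d])
  /\ ~ (exists t : R, upper_density_threshold k t).
Proof.
(* Stated for every real [delta], so that it also applies to a supposed threshold [t] of unknown
   sign. *)
have dense delta : exists (n : nat) (d : 'I_n -> nat),
    [/\ positive_deadlines d, delta < dens R d & kvisits_schedulable k d].
  have [n ltn] := harmonic_sum_unbounded (k%:R * delta).
  exists n, (@block_deadline n k); split=> //.
    apply: lt_le_trans (dens_block_deadline n hk R).
    by rewrite ltr_pdivlMl ?ltr0n.
  by exists (block_schedule n hk); exact: block_schedule_kvisits.
split=> [delta _|[t [none_above _]]]; first exact: dense.
by have [n [d [d_gt0 ltt]]] := dense t; exact: none_above.
Qed.
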